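(* Let $\Phi$ be a random dynamical system on a separable Banach space $\mathbb{X}$ over a metric dynamical system $(\Omega,\mathcal{F},P,(\theta_t)_{t\in\mathbb{R}})$, and suppose that $\Phi$ has a random periodic path $Y$ of period $\tau>0$. Let $\mu_s$, $s\in\mathbb{R}$, be the measures on $(\bar\Omega,\bar{\mathcal{F}})=(\Omega\times\mathbb{X},\mathcal{F}\otimes\mathcal{B}(\mathbb{X}))$ given by $\mu_s(A)=\int_\Omega\delta_{Y(s,\omega)}(A_{\theta_s\omega})P(d\omega)$, and let $(\bar\Theta_t)_{t\ge0}$ be the skew product. If $(\bar\Omega,\bar{\mathcal{F}},\mu_s,(\bar\Theta_\tau^n)_{n\ge0})$ is ergodic for some $s\in\mathbb{R}$, then $(\Omega,\mathcal{F},P,(\theta_\tau^n)_{n\ge0})$ is ergodic.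
   Context: Metric dynamical system: a probability space $(\Omega,\mathcal{F},P)$ with a $(\mathcal{B}(\mathbb{R})\otimes\mathcal{F},\mathcal{F})$-measurable map $\theta:\mathbb{R}\times\Omega\to\Omega$ such that $\theta_t\circ\theta_s=\theta_{t+s}$ and $\theta_tP=P$ for all $s,t\in\mathbb{R}$ (with $\theta_0=\mathrm{id}$). Random dynamical system: a measurable map $\Phi:\mathbb{R}^+\times\Omega\times\mathbb{X}\to\mathbb{X}$ such that, almost surely, $\Phi(0,\omega)=\mathrm{id}$ and $\Phi(t+s,\omega)=\Phi(t,\theta_s\omega)\circ\Phi(s,\omega)$ for all $t,s\ge0$. Random periodic path of period $\tau$: a $(\mathcal{B}(\mathbb{R})\otimes\mathcal{F},\mathcal{B}(\mathbb{X}))$-measurable map $Y:\mathbb{R}\times\Omega\to\mathbb{X}$ such that for almost all $\omega$, $\Phi(t,\theta_s\omega)Y(s,\omega)=Y(t+s,\omega)$ and $Y(s+\tau,\omega)=Y(s,\theta_\tau\omega)$ for all $t\ge0$, $s\in\mathbb{R}$. Skew product: $\bar\Theta_t(\omega,x)=(\theta_t\omega,\Phi(t,\omega)x)$, $t\ge 0$. $A_\omega=\{x:(\omega,x)\in A\}$ denotes the $\omega$-section of $A$. Equivalently $\mu_s(A)=P(\{\omega:(\omega,Y(s,\theta_{-s}\omega))\in A\})$. It is known that $\mu_{s+\tau}=\mu_s$ and $\bar\Theta_t\mu_s=\mu_{t+s}$ for all $t\ge0,s\in\mathbb{R}$. A measure preserving dynamical system is ergodic if every invariant measurable set ($\bar\Theta_\tau^{-1}A=A$,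 resp. $\theta_\tau^{-1}A=A$) has measure $0$ or $1$. *)

(* Defs.v *)
From HB Require Import structures.
From mathcomp Require Import all_boot all_order all_algebra.
From mathcomp Require Import all_classical all_reals all_analysis.

Set Implicit Arguments.
Unset Strict Implicit.
Unset Printing Implicit Defensive.

Import Order.TTheory GRing.Theory Num.Theory.
Import numFieldNormedType.Exports.

Local Open Scope classical_set_scope.
Local Open Scope ring_scope.

Definition separable_space (T : topologicalType) : Prop :=
  exists2 D : set T, countable D & dense D.

Notation borel T := (g_sigma_algebraType (@open T)).

(* A flow is uncurried, [theta (t, w)] being theta_t(w), so that its joint
   measurability is carried by its type. *)
Record metric_dynamical_system (R : realType) (d : measure_display)
    (Omega : measurableType d) (P : probability Omega R)
    (theta : {mfun (measurableTypeR R * Omega)%type >-> Omega}) : Prop := {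
  mds_id : forall w : Omega, theta (0, w) = w ;
  mds_comp : forall (t s : R) (w : Omega),
    theta (t, theta (s, w)) = theta (t + s, w) ;
  mds_invariant : forall (t : R) (A : set Omega), measurable A ->
    pushforward P (fun w => theta (t, w)) A = P A }.

(* [Phi t w x] is only constrained for [0 <= t]; its values at negative times
   are irrelevant. As [0, +oo) is Borel, measurability on the domain below is
   measurability with respect to B(R^+) (x) F (x) B(X). The exceptional null
   set does not depend on the times. *)
Record random_dynamical_system (R : realType) (d : measure_display)
    (Omega : measurableType d) (P : probability Omega R)
    (theta : {mfun (measurableTypeR R * Omega)%type >-> Omega})
    (X : completeNormedModType R) (Phi : R -> Omega -> X -> X) : Prop := {
  rds_measurable : measurable_fun
    [set p : measurableTypeR R * Omega * borel X | 0 <= (p.1.1 : R)]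
    (fun p : measurableTypeR R * Omega * borel X =>
       Phi p.1.1 p.1.2 p.2 : borel X) ;
  rds_cocycle : {ae P, forall w : Omega, Phi 0 w = id /\
    forall t s : R, 0 <= t -> 0 <= s ->
      Phi (t + s) w = Phi t (theta (s, w)) \o Phi s w} }.

Definition random_periodic_path (R : realType) (d : measure_display)
    (Omega : measurableType d) (P : probability Omega R)
    (theta : {mfun (measurableTypeR R * Omega)%type >-> Omega})
    (X : completeNormedModType R) (Phi : R -> Omega -> X -> X) (tau : R)
    (Y : {mfun (measurableTypeR R * Omega)%type >-> borel X}) : Prop :=
  {ae P, forall w : Omega, forall t s : R, 0 <= t ->
    Phi t (theta (s, w)) (Y (s, w)) = Y (t + s, w) /\
    Y (s + tau, w) = Y (s, theta (tau, w))}.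

Definition skew_product (R : realType) (d : measure_display)
    (Omega : measurableType d)
    (theta : {mfun (measurableTypeR R * Omega)%type >-> Omega})
    (X : completeNormedModType R) (Phi : R -> Omega -> X -> X) (t : R)
    (p : Omega * borel X) : Omega * borel X :=
  (theta (t, p.1), Phi t p.1 p.2).

Definition periodic_measure (R : realType) (d : measure_display)
    (Omega : measurableType d) (P : probability Omega R)
    (theta : {mfun (measurableTypeR R * Omega)%type >-> Omega})
    (X : completeNormedModType R)
    (Y : {mfun (measurableTypeR R * Omega)%type >-> borel X}) (s : R)
    (A : set (Omega * borel X)) : \bar R :=
  (\int[P]_w \d_(Y (s, w)) (xsection A (theta (s, w))))%E.

Section periodic_measure_probability.
Context (R : realType) (d : measure_display) (Omega : measurableType d)
  (P : probability Omega R)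
  (theta : {mfun (measurableTypeR R * Omega)%type >-> Omega})
  (X : completeNormedModType R)
  (Y : {mfun (measurableTypeR R * Omega)%type >-> borel X}) (s : R).
Local Open Scope ereal_scope.

Let graph (w : Omega) : Omega * borel X := (theta (s, w), Y (s, w)).

Let mgraph : measurable_fun setT graph.
Proof.
apply/measurable_fun_pairP; split.
  exact: (measurableT_comp (measurable_funPT theta) (pair1_measurable _)).
exact: (measurableT_comp (measurable_funPT Y) (pair1_measurable _)).
Qed.

Let mgraph_preimage (A : set (Omega * borel X)) :
  measurable A -> measurable (graph @^-1` A).
Proof. by move=> mA; rewrite -[X in measurable X]setTI; exact: mgraph. Qed.

Lemma periodic_measureE (A : set (Omega * borel X)) : measurable A ->
  periodic_measure P theta Y s A = P [set w | A (theta (s, w), Y (s, w))].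
Proof.
move=> mA; rewrite /periodic_measure.
under eq_integral => w _.
  rewrite diracE (_ : _%:R = \1_(graph @^-1` A) w); last first.
    rewrite indicE; congr (nat_of_bool _)%:R.
    by apply/idP/idP; rewrite !inE /xsection /= inE.
  over.
by rewrite integral_indic ?setIT//; exact: mgraph_preimage.
Qed.

Let periodic_measure0 : periodic_measure P theta Y s set0 = 0.
Proof. by rewrite periodic_measureE// measure0. Qed.

Let periodic_measure_ge0 A : 0 <= periodic_measure P theta Y s A.
Proof. exact: integral_ge0. Qed.

Let periodic_measure_sigma_additive :
  semi_sigma_additive (periodic_measure P theta Y s).
Proof.
move=> F mF tF mUF; rewrite periodic_measureE//.
under eq_fun do (under eq_bigr do rewrite periodic_measureE//).
exact: (@measure_semi_sigma_additive _ _ _ (pushforward P graph)).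
Qed.

HB.instance Definition _ := isMeasure.Build _ _ _
  (periodic_measure P theta Y s)
  periodic_measure0 periodic_measure_ge0 periodic_measure_sigma_additive.

Let periodic_measure_setT : periodic_measure P theta Y s setT = 1.
Proof. by rewrite periodic_measureE//= probability_setT. Qed.

HB.instance Definition _ := Measure_isProbability.Build _ _ _
  (periodic_measure P theta Y s) periodic_measure_setT.

End periodic_measure_probability.

Definition measure_preserving (R : realType) (d : measure_display)
    (T : measurableType d) (mu : probability T R) (f : T -> T) : Prop :=
  measurable_fun setT f /\
  forall A : set T, measurable A -> pushforward mu f A = mu A.

(* Ergodicity of the discrete-time system (T, mu, (f^n)_{n >= 0}). *)
Definition ergodic (R : realType) (d : measure_display)
    (T : measurableType d) (mu : probability T R) (f : T -> T) : Prop :=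
  measure_preserving mu f /\
  forall A : set T, measurable A -> f @^-1` A = A ->
    (mu A = 0 \/ mu A = 1)%E.

(* Main.v *)
(** The cylinder [A x X] over a [theta_tau]-invariant set [A] is invariant under
    the skew product, whose base component is [theta_tau], and its [mu_s]-measure
    is [P (theta_s^-1 A) = P A]. *)

Require Import Defs.
From mathcomp Require Import all_boot all_order all_algebra.
From mathcomp Require Import all_classical all_reals all_analysis.

Set Implicit Arguments.
Unset Strict Implicit.
Unset Printing Implicit Defensive.

Import Order.TTheory GRing.Theory Num.Theory.
Import numFieldNormedType.Exports.

Local Open Scope classical_set_scope.
Local Open Scope ring_scope.

(** Ergodicity passes to factors. The projection to [Omega] intertwines the skew product with
    [theta_tau] and sends [mu_s] to [P], because the base point is [theta_s w] and [theta_s]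
    preserves [P]. The zero-one law for cylinders is thus the one for base sets. *)

Theorem theorem2p11 (R : realType) (d : measure_display)
    (Omega : measurableType d) (P : probability Omega R)
    (theta : {mfun (measurableTypeR R * Omega)%type >-> Omega})
    (X : completeNormedModType R) (Phi : R -> Omega -> X -> X) (tau : R)
    (Y : {mfun (measurableTypeR R * Omega)%type >-> borel X})
    (X_separable : separable_space X)
    (theta_mds : metric_dynamical_system P theta)
    (Phi_rds : random_dynamical_system P theta Phi)
    (tau_gt0 : 0 < tau)
    (Y_periodic : random_periodic_path P theta Phi tau Y)
    (mu_ergodic : exists s : R,
      ergodic (periodic_measure P theta Y s) (skew_product theta Phi tau)) :
  ergodic P (fun w => theta (tau, w)).
Proof.
have [s [_ skew_ergodic]] := mu_ergodic.
have mtheta_tau : measurable_fun setT (fun w => theta (tau, w)).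
  exact: (measurableT_comp (measurable_funPT theta) (pair1_measurable _)).
split; first by split=> // A; exact: mds_invariant.
move=> A mA A_invariant.
have mcylinder : measurable (A `*` [set: borel X]) by exact: measurableX.
have cylinderE : periodic_measure P theta Y s (A `*` [set: borel X]) = P A.
  rewrite periodic_measureE// -(mds_invariant theta_mds s mA).
  by congr (P _); apply/seteqP; split=> [w []|w].
rewrite -cylinderE; apply: skew_ergodic => //.
(* Only the right-hand [A] becomes its [theta_tau]-preimage; both sides then state the same
   condition on the base point. *)
rewrite -{2}A_invariant.
by apply/seteqP; split=> [p []|p []].
Qed.
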